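(* Let $n\ge 3$, and let $(A,\Lambda)$ be an arbitrary form ring for which the absolute standard commutator formulae are satisfied. Then for any two comaximal form ideals $(I,\Gamma)$ and $(J,\Delta)$ of the form ring $(A,\Lambda)$, i.e. such that $I+J=A$, one has $$[\mathrm{EU}(2n,I,\Gamma),\mathrm{EU}(2n,J,\Delta)]=\mathrm{EU}\big(2n,\,IJ+JI,\,{}^J\Gamma+{}^I\Delta+\Gamma_{\min}(IJ+JI)\big).$$
   Context: Rings are associative with $1$ (not necessarily commutative). **Form rings.** Let $A$ be a ring with an involution $\alpha\mapsto\bar\alpha$ (so $\overline{\alpha+\beta}=\bar\alpha+\bar\beta$, $\overline{\alpha\beta}=\bar\beta\bar\alpha$, $\bar{\bar\alpha}=\alpha$), and fix a central element $\lambda\in A$ with $\lambda\bar\lambda=1$. Put $\Lambda_{\min}=\{\alpha-\lambda\bar\alpha\mid\alpha\in A\}$ and $\Lambda_{\max}=\{\alpha\in A\mid\alpha=-\lambda\bar\alpha\}$. A form parameter is an additive subgroup $\Lambda$ of $A$ with $\Lambda_{\min}\subseteq\Lambda\subseteq\Lambda_{\max}$ and $\alpha\Lambda\bar\alpha\subseteq\Lambda$ for all $\alpha\in A$; the pair $(A,\Lambda)$ is a form ring. **Form ideals.** Let $I$ be a two-sided ideal of $A$ with $\bar I=I$. Put $\Gamma_{\max}(I)=I\cap\Lambda$ and $\Gamma_{\min}(I)=\{\xi-\lambda\bar\xi\mid\xi\in I\}+\langle\xi\alpha\bar\xi\mid\xi\in I,\alpha\in\Lambda\rangle$ (additive subgroup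 generated). A form ideal is a pair $(I,\Gamma)$ where $\Gamma$ is an additive subgroup of $I$ with $\Gamma_{\min}(I)\subseteq\Gamma\subseteq\Gamma_{\max}(I)$ and $\alpha\Gamma\bar\alpha\subseteq\Gamma$ for all $\alpha\in A$. For form ideals $(I,\Gamma)$, $(J,\Delta)$ put ${}^J\Gamma=\langle\xi\gamma\bar\xi\mid\xi\in J,\gamma\in\Gamma\rangle$ and ${}^I\Delta=\langle\xi\delta\bar\xi\mid\xi\in I,\delta\in\Delta\rangle$ (additive subgroups generated); then $(IJ+JI,{}^J\Gamma+{}^I\Delta+\Gamma_{\min}(IJ+JI))$ is a form ideal. **Unitary groups.** Let $V=A^{2n}$ be the free right $A$-module of columns indexed by $\Omega=\{1,\dots,n,-n,\dots,-1\}$; put $\varepsilon(i)=+1$ for $i>0$ and $\varepsilon(i)=-1$ for $i<0$. Let $f(u,v)=\bar u_1v_{-1}+\dots+\bar u_nv_{-n}$, $h(u,v)=f(u,v)+\lambda\overline{f(v,u)}$, and $q(u)=f(u,u)\bmod\Lambda\in A/\Lambda$. The group $\mathrm{GU}(2n,A,\Lambda)$ consists of all $g\in\mathrm{GL}(2n,A)$ with $h(gu,gv)=h(u,v)$ and $q(gu)=q(u)$ for all $u,v\in V$. For $i,j\in\Omega$, $i\ne\pm j$, $\xi\in A$, put $T_{ij}(\xi)=e+\xi e_{ij}-\lambda^{(\varepsilon(j)-\varepsilon(i))/2}\bar\xi e_{-j,-i}$; for $\alpha\in\lambda^{-(\varepsilon(i)+1)/2}\Lambda$ put $T_{i,-i}(\alpha)=e+\alpha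 e_{i,-i}$. For a form ideal $(I,\Gamma)$: $\mathrm{FU}(2n,I,\Gamma)$ is the group generated by all $T_{ij}(\xi)$ with $i\neq\pm j$, $\xi\in I$, and all $T_{i,-i}(\xi)$ with $\xi\in\lambda^{-(\varepsilon(i)+1)/2}\Gamma$; $\mathrm{EU}(2n,A,\Lambda)=\mathrm{FU}(2n,A,\Lambda)$; $\mathrm{EU}(2n,I,\Gamma)$ is the normal closure of $\mathrm{FU}(2n,I,\Gamma)$ in $\mathrm{EU}(2n,A,\Lambda)$; $\mathrm{GU}(2n,I,\Gamma)$ is the group of all $g\in\mathrm{GU}(2n,A,\Lambda)$ with $g\equiv e\pmod I$ and $f(gu,gu)\in f(u,u)+\Gamma$ for all $u\in V$; and $\mathrm{CU}(2n,I,\Gamma)=\{g\in\mathrm{GU}(2n,A,\Lambda)\mid[g,\mathrm{GU}(2n,A,\Lambda)]\subseteq\mathrm{GU}(2n,I,\Gamma)\}$. $[x,y]=xyx^{-1}y^{-1}$, and for subgroups $H,K$, $[H,K]$ is the subgroup generated by all $[x,y]$, $x\in H$, $y\in K$. **Absolute standard commutator formulae.** These are satisfied for $(A,\Lambda)$ if for every form ideal $(I,\Gamma)$ of $(A,\Lambda)$ one has $\mathrm{EU}(2n,I,\Gamma)=[\mathrm{GU}(2n,A,\Lambda),\mathrm{EU}(2n,I,\Gamma)]$ and $\mathrm{EU}(2n,I,\Gamma)=[\mathrm{EU}(2n,A,\Lambda),\mathrm{CU}(2n,I,\Gamma)]$. *)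

(* Defs.v *)
From HB Require Import structures.
From mathcomp Require Import all_boot all_order all_algebra.
From mathcomp Require Import boolp classical_sets.

Set Implicit Arguments.
Unset Strict Implicit.
Unset Printing Implicit Defensive.

Import GRing.Theory.
Local Open Scope classical_set_scope.
Local Open Scope ring_scope.

Section AdditiveSubgroups.
Variable A : pzRingType.
Implicit Types X Y : set A.

Definition additive_subgroup X :=
  [/\ X 0, forall x y, X x -> X y -> X (x + y) & forall x, X x -> X (- x)].

Definition addgen X : set A := smallest additive_subgroup X.

Definition sumset X Y : set A := [set x + y | x in X & y in Y].

Definition ideal_product X Y : set A := addgen [set x * y | x in X & y in Y].

Definition two_sided_ideal X :=
  additive_subgroup X /\ forall a x, X x -> X (a * x) /\ X (x * a).

End AdditiveSubgroups.

Section FormParameters.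
Variables (A : pzRingType) (bar : A -> A) (lambda : A).

Definition is_involution :=
  [/\ {morph bar : x y / x + y}, {morph bar : x y / x * y >-> y * x}
    & involutive bar].

Definition Lambda_min : set A := [set a - lambda * bar a | a in setT].

Definition Lambda_max : set A := [set a | a = - (lambda * bar a)].

Definition form_parameter (Lambda : set A) :=
  [/\ additive_subgroup Lambda, Lambda_min `<=` Lambda, Lambda `<=` Lambda_max
    & forall a x, Lambda x -> Lambda (a * x * bar a)].

End FormParameters.

Record formRing := FormRing {
  fr_ring :> pzRingType;
  bar : fr_ring -> fr_ring;
  lambda : fr_ring;
  Lambda : set fr_ring;
  bar_involution : is_involution bar;
  lambda_central : forall a, lambda * a = a * lambda;
  lambda_bar : lambda * bar lambda = 1;
  Lambda_form_parameter : form_parameter bar lambda Lambda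
}.

Arguments bar {f} _.
Arguments Lambda f _ : clear implicits.

Section FormIdeals.
Variable A : formRing.
Implicit Types I J Gamma Delta : set A.

Definition Gamma_max I : set A := I `&` Lambda A.

(* [twisted J Gamma] is the additive subgroup usually written with J as a left
   superscript of Gamma. *)
Definition twisted J Gamma : set A :=
  addgen [set x * g * bar x | x in J & g in Gamma].

Definition Gamma_min I : set A :=
  sumset [set x - lambda A * bar x | x in I] (twisted I (Lambda A)).

Definition form_ideal I Gamma :=
  [/\ two_sided_ideal I, bar @` I = I, additive_subgroup Gamma,
      Gamma_min I `<=` Gamma /\ Gamma `<=` Gamma_max I
    & forall a x, Gamma x -> Gamma (a * x * bar a)].

Definition sym_product I J : set A :=
  sumset (ideal_product I J) (ideal_product J I).

Definition sym_product_parameter I Gamma J Delta : set A :=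
  sumset (sumset (twisted J Gamma) (twisted I Delta))
         (Gamma_min (sym_product I J)).

End FormIdeals.

(* The general linear group over a ring that need not be commutative: pairs of
   mutually inverse matrices. The second component is determined by the first
   (see [GL_mx_inj]). *)
Section GeneralLinearGroup.
Variables (m : nat) (A : pzRingType).

Record GL := MkGL {
  GL_pair : 'M[A]_m * 'M[A]_m;
  _ : (GL_pair.1 *m GL_pair.2 == 1%:M) && (GL_pair.2 *m GL_pair.1 == 1%:M)
}.

HB.instance Definition _ := [isSub for GL_pair].
HB.instance Definition _ := [Choice of GL by <:].

Definition GL_mx (g : GL) : 'M[A]_m := (GL_pair g).1.

Lemma GL_mulmxV (g : GL) : GL_mx g *m (GL_pair g).2 = 1%:M.
Proof. by rewrite /GL_mx; case: g => p /= /andP[/eqP]. Qed.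

Lemma GL_mulVmx (g : GL) : (GL_pair g).2 *m GL_mx g = 1%:M.
Proof. by rewrite /GL_mx; case: g => p /= /andP[_ /eqP]. Qed.

Lemma GL_mx_inj : injective GL_mx.
Proof.
move=> g h gh; apply: val_inj.
have gh2 : (GL_pair g).2 = (GL_pair h).2.
  by rewrite -[LHS]mulmx1 -(GL_mulmxV h) mulmxA -gh GL_mulVmx mul1mx.
by rewrite [LHS]surjective_pairing [RHS]surjective_pairing gh2; congr pair.
Qed.

Fact GL_one_subproof :
  ((1%:M : 'M[A]_m) *m (1%:M : 'M[A]_m) == 1%:M)
    && ((1%:M : 'M[A]_m) *m (1%:M : 'M[A]_m) == 1%:M).
Proof. by rewrite mulmx1 eqxx. Qed.

Definition GL_one : GL := @MkGL (1%:M, 1%:M) GL_one_subproof.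

Fact GL_inv_subproof (g : GL) :
  ((GL_pair g).2 *m (GL_pair g).1 == 1%:M)
    && ((GL_pair g).1 *m (GL_pair g).2 == 1%:M).
Proof. by rewrite andbC; case: g. Qed.

Definition GL_inv (g : GL) : GL :=
  @MkGL ((GL_pair g).2, (GL_pair g).1) (GL_inv_subproof g).

Fact GL_mul_subproof (g h : GL) :
  (((GL_pair g).1 *m (GL_pair h).1) *m ((GL_pair h).2 *m (GL_pair g).2) == 1%:M)
    && (((GL_pair h).2 *m (GL_pair g).2) *m ((GL_pair g).1 *m (GL_pair h).1)
          == 1%:M).
Proof.
rewrite !mulmxA -(mulmxA (GL_pair g).1) GL_mulmxV mulmx1 GL_mulmxV.
by rewrite -(mulmxA (GL_pair h).2) GL_mulVmx mulmx1 GL_mulVmx eqxx.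
Qed.

Definition GL_mul (g h : GL) : GL :=
  @MkGL ((GL_pair g).1 *m (GL_pair h).1, (GL_pair h).2 *m (GL_pair g).2)
    (GL_mul_subproof g h).

Fact GL_mulA : associative GL_mul.
Proof. by move=> g h k; apply: GL_mx_inj; rewrite /GL_mx /= mulmxA. Qed.

Fact GL_mul1 : left_id GL_one GL_mul.
Proof. by move=> g; apply: GL_mx_inj; rewrite /GL_mx /= mul1mx. Qed.

Fact GL_mulr1 : right_id GL_one GL_mul.
Proof. by move=> g; apply: GL_mx_inj; rewrite /GL_mx /= mulmx1. Qed.

Fact GL_mulV : left_inverse GL_one GL_inv GL_mul.
Proof. by move=> g; apply: GL_mx_inj; rewrite /GL_mx /= GL_mulVmx. Qed.

Fact GL_mulrV : right_inverse GL_one GL_inv GL_mul.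
Proof. by move=> g; apply: GL_mx_inj; rewrite /GL_mx /= GL_mulmxV. Qed.

HB.instance Definition _ :=
  isGroup.Build GL GL_mulA GL_mul1 GL_mulr1 GL_mulV GL_mulrV.

End GeneralLinearGroup.

Section Subgroups.
Variable G : groupType.
Implicit Types (x y : G) (H K X : set G).
Local Open Scope group_scope.

Definition subgroup H :=
  [/\ H 1, forall x y, H x -> H y -> H (x * y) & forall x, H x -> H x^-1].

Definition gengroup X : set G := smallest subgroup X.

(* The convention is x y x^-1 y^-1, not the library's x^-1 y^-1 x y. *)
Definition comm x y : G := x * y * x^-1 * y^-1.

Definition commgroup H K : set G := gengroup [set comm x y | x in H & y in K].

(* For H contained in K, the subgroup generated by the K-conjugates of H. *)
Definition normal_closure H K : set G :=
  gengroup [set x * y * x^-1 | x in K & y in H].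

End Subgroups.

(* The index set {1, ..., n, -n, ..., -1} is 'I_(2 * n), listed in this order:
   positions k < n carry the positive indices, and negation is [rev_ord]. *)
Section Unitary.
Variables (A : formRing) (n : nat).
Local Notation Omega := 'I_(2 * n).
Local Notation V := 'cV[A]_(2 * n).
Implicit Types (i j : Omega) (u v : V) (g : GL (2 * n) A) (I Gamma : set A).

Definition opp_idx i : Omega := rev_ord i.

Definition eps i : int := if (i < n)%N then 1 else -1.

(* Integer powers of lambda, whose inverse is [bar lambda]. *)
Definition lambda_pow (k : int) : A :=
  match k with
  | Posz p => lambda A ^+ p
  | Negz p => bar (lambda A) ^+ p.+1
  end.

Definition form_f u v : A :=
  \sum_(i : Omega | (i < n)%N) bar (u i 0) * v (opp_idx i) 0.

Definition form_h u v : A := form_f u v + lambda A * bar (form_f v u).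

(* The last clause is the equality q (g u) = q u in A / Lambda. *)
Definition GU : set (GL (2 * n) A) := [set g |
  (forall u v, form_h (GL_mx g *m u) (GL_mx g *m v) = form_h u v) /\
  (forall u, Lambda A (form_f (GL_mx g *m u) (GL_mx g *m u) - form_f u u))].

(* Both integer divisions by 2 below are exact. *)
Definition T_mx i j (xi : A) : 'M[A]_(2 * n) :=
  1%:M + xi *: delta_mx i j
  - (lambda_pow ((eps j - eps i) %/ 2)%Z * bar xi)
      *: delta_mx (opp_idx j) (opp_idx i).

Definition T_opp_mx i (alpha : A) : 'M[A]_(2 * n) :=
  1%:M + alpha *: delta_mx i (opp_idx i).

Definition scaled_parameter i Gamma : set A :=
  [set lambda_pow (- ((eps i + 1) %/ 2)%Z) * x | x in Gamma].

Definition elementary_gen I Gamma : set (GL (2 * n) A) :=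
  [set g | exists i j xi,
     [/\ i != j, i != opp_idx j, I xi & GL_mx g = T_mx i j xi]] `|`
  [set g | exists i, exists2 alpha,
     scaled_parameter i Gamma alpha & GL_mx g = T_opp_mx i alpha].

Definition FU I Gamma : set (GL (2 * n) A) := gengroup (elementary_gen I Gamma).

Definition EUabs : set (GL (2 * n) A) := FU setT (Lambda A).

Definition EU I Gamma : set (GL (2 * n) A) :=
  normal_closure (FU I Gamma) EUabs.

Definition GUrel I Gamma : set (GL (2 * n) A) := [set g |
  [/\ GU g, forall i j, I ((GL_mx g - 1%:M) i j)
    & forall u, Gamma (form_f (GL_mx g *m u) (GL_mx g *m u) - form_f u u)]].

Definition CU I Gamma : set (GL (2 * n) A) := [set g |
  GU g /\ forall x, GU x -> GUrel I Gamma (comm g x)].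

Definition absolute_standard_commutator_formulae :=
  forall I Gamma, form_ideal I Gamma ->
    EU I Gamma = commgroup GU (EU I Gamma) /\
    EU I Gamma = commgroup EUabs (CU I Gamma).

(* The matrices above are invertible, so describing the generators by their
   matrices loses none of them. *)
Lemma unipotent_GL (N : 'M[A]_(2 * n)) :
  N *m N = 0 -> exists g, GL_mx g = 1%:M + N.
Proof.
move=> N2.
have N1 : (1%:M + N) *m (1%:M - N) == 1%:M.
  by rewrite mulmxDl mul1mx mulmxBr mulmx1 N2 subr0 subrK.
have N1' : (1%:M - N) *m (1%:M + N) == 1%:M.
  by rewrite mulmxBl mul1mx mulmxDr mulmx1 N2 addr0 addrK.
have P : ((1%:M + N, 1%:M - N).1 *m (1%:M + N, 1%:M - N).2 == 1%:M)
    && ((1%:M + N, 1%:M - N).2 *m (1%:M + N, 1%:M - N).1 == 1%:M).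
  by rewrite /= N1 N1'.
by exists (MkGL P).
Qed.

Lemma opp_idx_neq i : opp_idx i != i.
Proof.
apply/eqP => /(congr1 val) /= E; have := ltn_ord i => lt_i.
have : odd (i + (2 * n - i.+1)).+1 by rewrite E addnn /= odd_double.
by rewrite -addSn subnKC // mul2n odd_double.
Qed.

Lemma mul_scale_delta (a b : A) i j (k l : Omega) : j != k ->
  (a *: delta_mx i j) *m (b *: delta_mx k l) = 0 :> 'M[A]_(2 * n).
Proof.
move=> jk; apply/matrixP => r s; rewrite !mxE big1 // => t _; rewrite !mxE.
have [-> | _] := eqVneq t j; last by rewrite andbF mulr0 mul0r.
by rewrite (negbTE jk) !mulr0.
Qed.

Lemma T_mx_GL i j xi : i != j -> exists g, GL_mx g = T_mx i j xi.
Proof.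
move=> ij; rewrite /T_mx -addrA; apply: unipotent_GL.
have neq_opp : opp_idx i != opp_idx j by rewrite (inj_eq rev_ord_inj).
rewrite mulmxDl !mulmxDr !(mulmxN, mulNmx).
by rewrite !mul_scale_delta ?oppr0 ?addr0 ?opp_idx_neq // eq_sym // opp_idx_neq.
Qed.

Lemma T_opp_mx_GL i alpha : exists g, GL_mx g = T_opp_mx i alpha.
Proof. by apply: unipotent_GL; rewrite mul_scale_delta // opp_idx_neq. Qed.

End Unitary.

Arguments EU {A} n I Gamma _.

(* Main.v *)
Require Import Defs.
From mathcomp Require Import all_boot all_order all_algebra.
From mathcomp Require Import boolp classical_sets ssrAC.
Set Implicit Arguments.
Unset Strict Implicit.
Unset Printing Implicit Defensive.
Import GRing.Theory.
Local Open Scope classical_set_scope.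
Local Open Scope ring_scope.

(** Comaximality turns both parameters of the right-hand side into
    intersections: writing 1 = u + v with u in I and v in J, every x in
    I `&` J equals x * v + x * u, so IJ + JI = I `&` J
    ([sym_product_comaximal]); expanding a = (u + v) a (u + v)^bar for a in
    Gamma `&` Delta expresses a by two twisted terms and one hermitian term,
    so the relative form parameter is Gamma `&` Delta
    ([sym_product_parameter_comaximal]).  The same expansion applied to
    Lambda gives Lambda = Gamma + Delta, hence the absolute elementary group E
    is generated by H = EU (I, Gamma) and K = EU (J, Delta)
    ([EUabs_comaximal]).

    Put L = EU (I `&` J, Gamma `&` Delta).  All that remains is group theory
    ([commgroup_factors]) with three inputs: the groups H, K, L are normal
    in E; they satisfy H = [H, E] and L = [L, E] ([EU_perfect], where n >= 3
    leaves room for a third index in the elementary relations); and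
    [[H, K], E] <= L.  For the last one, the relative congruence groups
    GU (I, Gamma) are normal in GU and contain the relative elementary groups,
    so [H, K] lies in both congruence groups, that is, in
    GU (I `&` J, Gamma `&` Delta), which sits inside CU of the same form
    ideal; the commutator of CU with E is L by the standard commutator
    formula.

    Granting the inputs, L = [L, E] is generated by conjugates of
    commutators of L with H and with K, all of which lie in [H, K].
    Conversely H = [H, E] is generated modulo [H, K] by [H, H], so [H, K] <= L
    follows from [[H, K], K] <= L and, by the Hall-Witt identity, from
    [[H, K], H] <= L. *)

(** * Commutators and normal closures in an abstract group *)

Section CommutatorCalculus.
Variable G : groupType.
Implicit Types (x y z : G) (X Y H K L N E : set G).
Local Open Scope group_scope.

Definition normalises E N := forall e x, E e -> N x -> N (e * x * e^-1).

Lemma gengroup_subgroup X : subgroup (gengroup X).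
Proof.
split=> [S [[] //]|x y hx hy S hS|x hx S hS].
  by case: (hS) => -[_ hM _] _; apply: hM; [exact: hx|exact: hy].
by case: (hS) => -[_ _ hV] _; apply: hV; exact: hx.
Qed.

Lemma sub_gengroup X : X `<=` gengroup X.
Proof. exact: sub_smallest. Qed.

Lemma gengroup_sub X N : subgroup N -> X `<=` N -> gengroup X `<=` N.
Proof. exact: smallest_sub. Qed.

Lemma conj_subgroup N e : subgroup N -> subgroup [set x | N (e * x * e^-1)].
Proof.
case=> N1 NM NV; split => /= [|x y hx hy|x hx].
- by rewrite mulg1 mulgV.
- by have := NM _ _ hx hy; rewrite !mulgA mulgVK.
- by have := NV _ hx; rewrite !invgM invgK !mulgA.
Qed.

Lemma normalises_gengroup E X :
  normalises E X -> normalises E (gengroup X).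
Proof.
move=> EX e x Ee; apply: (gengroup_sub (conj_subgroup e (gengroup_subgroup X))).
by move=> y Xy /=; apply: sub_gengroup; apply: EX.
Qed.

Lemma normal_closure_subgroup H E : subgroup (normal_closure H E).
Proof. exact: gengroup_subgroup. Qed.

Lemma normalises_normal_closure H E :
  subgroup E -> normalises E (normal_closure H E).
Proof.
case=> _ EM _; apply: normalises_gengroup => e _ Ee [x Ex] [y Hy] <-.
by exists (e * x); [exact: EM|exists y => //; rewrite invgM !mulgA].
Qed.

Lemma sub_normal_closure H E : subgroup E -> H `<=` normal_closure H E.
Proof.
case=> E1 _ _ x Hx; apply: sub_gengroup.
by exists 1 => //; exists x => //; rewrite invg1 mulg1 mul1g.
Qed.

Lemma normal_closure_sub H E N :
  subgroup N -> normalises E N -> H `<=` N -> normal_closure H E `<=` N.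
Proof.
move=> sN EN HN; apply: gengroup_sub => // _ [x Ex] [y Hy] <-.
by apply: EN => //; apply: HN.
Qed.

Lemma commMl x y z : comm (x * y) z = x * comm y z * x^-1 * comm x z.
Proof. by rewrite /comm !invgM !mulgA !(mulgVK, mulgK). Qed.

Lemma commMr x y z : comm x (y * z) = comm x y * (y * comm x z * y^-1).
Proof. by rewrite /comm !invgM !mulgA !(mulgVK, mulgK). Qed.

Lemma commVr x y : comm x y^-1 = y^-1 * (comm x y)^-1 * y^-1^-1.
Proof. by rewrite /comm !invgM !invgK !mulgA mulVg mul1g ?(mulgVK, mulgK). Qed.

Lemma commVl x y : comm x^-1 y = x^-1 * (comm x y)^-1 * x^-1^-1.
Proof. by rewrite /comm !invgM !invgK !mulgA mulgVK. Qed.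

Lemma commV x y : (comm x y)^-1 = comm y x.
Proof. by rewrite /comm !invgM !invgK !mulgA. Qed.

Lemma conj_comm e x y :
  e * comm x y * e^-1 = comm (e * x * e^-1) (e * y * e^-1).
Proof. by rewrite /comm !invgM !invgK !mulgA !(mulgVK, mulgK). Qed.

Lemma commgroup_comm H K x y : H x -> K y -> commgroup H K (comm x y).
Proof. by move=> Hx Ky; apply: sub_gengroup; exists x => //; exists y. Qed.

Lemma commgroup_sub H K N : subgroup N ->
  (forall x y, H x -> K y -> N (comm x y)) -> commgroup H K `<=` N.
Proof. by move=> sN HK; apply: gengroup_sub => // _ [x Hx] [y Ky] <-; exact: HK. Qed.

Lemma normalises_commgroup E H K :
  normalises E H -> normalises E K -> normalises E (commgroup H K).
Proof.
move=> EH EK; apply: normalises_gengroup => e _ Ee [x Hx] [y Ky] <-.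
exists (e * x * e^-1); first exact: EH.
by exists (e * y * e^-1); [exact: EK|rewrite conj_comm].
Qed.

(** The identity [x, yz] = [x, y] . y[x, z]y^-1 makes the set of y with
    comm x y in N a subgroup of E, so generators suffice. *)
Lemma comm_gengroup E X N x : subgroup E -> subgroup N -> normalises E N ->
  X `<=` E -> (forall y, X y -> N (comm x y)) ->
  forall y, gengroup X y -> N (comm x y).
Proof.
move=> [E1 EM EV] [N1 NM NV] EN XE XN y Xy.
suff: (E `&` [set y | N (comm x y)]) y by case.
move: y Xy; apply: gengroup_sub => [|y Xy]; last by split; [exact: XE|exact: XN].
split=> [|y z [Ey Ny] [Ez Nz]|y [Ey Ny]]; split; rewrite /=.
- exact: E1.
- by rewrite /comm mulg1 mulgV invg1 mulg1.
- exact: EM.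
- by rewrite commMr; apply: NM => //; apply: EN.
- exact: EV.
- by rewrite commVr; apply: EN; [exact: EV|exact: NV].
Qed.

(** For the convention [x, y] = x y x^-1 y^-1: the three factors are
    a b^-1, b c^-1 and c a^-1, where a = x y x^-1 z x and where b, c arise from
    a by rotating the variables. *)
Lemma Hall_Witt x y z :
  (y * comm (comm y^-1 x) z * y^-1) * (z * comm (comm z^-1 y) x * z^-1)
    * (x * comm (comm x^-1 z) y * x^-1) = 1.
Proof.
rewrite /comm !invgM !invgK !mulgA !mulgV !mul1g.
by rewrite !(mulgVK, mulgK, mulgV, mul1g).
Qed.

(** The group-theoretic core: if E is generated by its normal subgroups H and
    K, and L is a normal subgroup inside both that absorbs [[H, K], E], then
    the perfectness of H and L relative to E forces [H, K] = L. *)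
Lemma commgroup_factors E H K L :
    subgroup E -> subgroup H -> subgroup K -> subgroup L ->
    normalises E H -> normalises E K -> normalises E L ->
    H `<=` E -> K `<=` E -> L `<=` H -> L `<=` K ->
    E `<=` gengroup (H `|` K) ->
    H `<=` commgroup H E -> L `<=` commgroup L E ->
    commgroup (commgroup H K) E `<=` L ->
  commgroup H K = L.
Proof.
move=> sE sH sK sL nH nK nL HE KE LH LK EHK HHE LLE HKL.
have HKE : H `|` K `<=` E by move=> x [/HE|/KE].
have [E1 EM EV] := sE; have [H1 HM HV] := sH; have [K1 KM KV] := sK.
have [L1 LM LV] := sL.
have HKeL z e : commgroup H K z -> E e -> L (comm z e).
  by move=> hz Ee; apply: HKL; apply: commgroup_comm.
have KHeL x y e : K x -> H y -> E e -> L (comm (comm x y) e).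
  move=> Kx Hy Ee; apply: HKeL => //; rewrite -commV.
  by case: (gengroup_subgroup [set comm x y | x in H & y in K]) => _ _; apply;
    exact: commgroup_comm.
rewrite eqEsubset; split; last first.
  apply: (subset_trans LLE); apply: commgroup_sub; first exact: gengroup_subgroup.
  move=> x y Lx Ey.
  apply: (comm_gengroup sE _ _ HKE _ (EHK _ Ey)).
  - exact: gengroup_subgroup.
  - exact: normalises_commgroup.
  - move=> z [Hz|Kz]; last by apply: commgroup_comm => //; apply: LH.
    rewrite -commV; case: (gengroup_subgroup [set comm x y | x in H & y in K]).
    by move=> _ _; apply; apply: commgroup_comm => //; apply: LK.
(* [H, K] <= L says that H centralises K modulo L.  The centraliser C of K
   modulo L is a normal subgroup of E, so it suffices to place in C the
   commutators of H with the generators of E. *)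
pose C := [set x | forall k, K k -> L (comm x k)] `&` E.
have sC : subgroup C.
  split=> [|x y [Cx Ex] [Cy Ey]|x [Cx Ex]]; split; rewrite /=.
  - by move=> k _; rewrite /comm mul1g invg1 mulg1 mulgV.
  - exact: E1.
  - move=> k Kk; rewrite commMl.
    by apply: (LM); [apply: (nL) => //; exact: Cy|exact: Cx].
  - exact: EM.
  - move=> k Kk; rewrite commVl; apply: (nL); first exact: EV.
    by apply: LV; exact: Cx.
  - exact: EV.
have nC : normalises E C.
  move=> e x Ee [Cx Ex]; split => /=; last by apply: (EM); [exact: EM|exact: EV].
  move=> k Kk; have := nK _ _ (EV _ Ee) Kk; rewrite invgK => Kk'.
  have := nL _ _ Ee (Cx _ Kk'); rewrite conj_comm !mulgA mulgV mul1g.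
  by rewrite mulgK.
suff HC : H `<=` C by apply: commgroup_sub => // x y /HC[Cx _]; exact: Cx.
apply: (subset_trans HHE); apply: commgroup_sub => // h e Hh Ee.
have Eh := HE _ Hh.
apply: (comm_gengroup sE sC nC HKE _ (EHK _ Ee)) => {e Ee} y HKy.
have Ey := HKE _ HKy.
split=> /=; last first.
  by rewrite /comm; apply: (EM); [apply: (EM); [exact: EM|exact: EV]|exact: EV].
move=> k Kk; have Ek := KE _ Kk.
case: HKy => [Hy|Ky]; last by apply: HKeL => //; exact: commgroup_comm.
(* For y in H both other factors of the Hall-Witt identity lie in L. *)
have /eqP := Hall_Witt y h^-1 k; rewrite invgK -mulgA mulg_eq1 => /eqP e.
have : L (h^-1 * comm (comm h y) k * h).
  rewrite e; apply: (LV); apply: (LM); apply: (nL) => //.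
    by apply: KHeL; [exact: KV|exact: HV|].
  by apply: HKeL; [apply: commgroup_comm; [exact: HV|]|apply: (EV)].
by move=> /(nL _ _ Eh); rewrite !mulgA mulgV mul1g mulgK.
Qed.
End CommutatorCalculus.

(** * Form ideals and comaximality *)

Section Involution.
Variable A : formRing.
Implicit Types (a b : A) (I J Gamma Delta X : set A).

Lemma barD : {morph @bar A : a b / a + b}.
Proof. by case: (bar_involution A). Qed.

Lemma barM a b : bar (a * b) = bar b * bar a.
Proof. by case: (bar_involution A) => _ ->. Qed.

Lemma barK : involutive (@bar A).
Proof. by case: (bar_involution A). Qed.

Lemma bar0 : bar (0 : A) = 0.
Proof. by apply: (addrI (bar 0)); rewrite -barD !addr0. Qed.

Lemma barN a : bar (- a) = - bar a.
Proof. by apply: (addrI (bar a)); rewrite -barD !subrr bar0. Qed.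

Lemma bar1 : bar (1 : A) = 1.
Proof. by rewrite -[LHS]mulr1 -[X in _ * X]barK -barM mulr1 barK. Qed.

Lemma bar_lambdaC a : bar (lambda A) * a = a * bar (lambda A).
Proof. by rewrite -[a]barK -!barM lambda_central. Qed.

Lemma mul_lambda_bar_lambda a : lambda A * (bar (lambda A) * a) = a.
Proof. by rewrite mulrA lambda_bar mul1r. Qed.

Lemma Lambda_barE a : Lambda A a -> lambda A * bar a = - a.
Proof.
by case: (Lambda_form_parameter A) => _ _ h _ /h /= {2}->; rewrite opprK.
Qed.

Lemma additive_subgroupB X a b :
  additive_subgroup X -> X a -> X b -> X (a - b).
Proof. by case=> _ hD hN Xa Xb; apply: hD => //; apply: hN. Qed.

Lemma addgen_sub (R : pzRingType) (X Y : set R) :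
  additive_subgroup Y -> X `<=` Y -> addgen X `<=` Y.
Proof. exact: smallest_sub. Qed.

Lemma sub_addgen (R : pzRingType) (X : set R) : X `<=` addgen X.
Proof. exact: sub_smallest. Qed.

Lemma addgen0 (R : pzRingType) (X : set R) : addgen X 0.
Proof. by move=> S [[]]. Qed.

Lemma additive_subgroupI (R : pzRingType) (X Y : set R) :
  additive_subgroup X -> additive_subgroup Y -> additive_subgroup (X `&` Y).
Proof.
case=> X0 XD XN [Y0 YD YN]; split=> [|x y [Xx Yx] [Xy Yy]|x [Xx Yx]]; split=> //;
by [exact: XD|exact: YD|exact: XN|exact: YN].
Qed.

Lemma form_ideal_bar I Gamma a : form_ideal I Gamma -> I a -> I (bar a).
Proof. by case=> _ IE _ _ _ Ia; rewrite -IE; exists a. Qed.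

Lemma form_ideal_hermitian I Gamma a :
  form_ideal I Gamma -> I a -> Gamma (a - lambda A * bar a).
Proof.
case=> _ _ _ [hmin _] _ Ia; apply: hmin; exists (a - lambda A * bar a).
  by exists a.
by exists 0; [exact: addgen0|rewrite addr0].
Qed.

Lemma form_ideal_twisted I Gamma a b :
  form_ideal I Gamma -> I a -> Lambda A b -> Gamma (a * b * bar a).
Proof.
case=> -[[I0 _ _] _] _ _ [hmin _] _ Ia Lb; apply: hmin.
exists 0; first by exists 0 => //; rewrite bar0 mulr0 subr0.
exists (a * b * bar a); last by rewrite add0r.
by apply: sub_addgen; exists a => //; exists b.
Qed.

Lemma form_ideal_Lambda I Gamma a : form_ideal I Gamma -> Gamma a -> Lambda A a.
Proof. by case=> _ _ _ [_ hmax] _ /hmax[]. Qed.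

Lemma form_ideal_sub I Gamma a : form_ideal I Gamma -> Gamma a -> I a.
Proof. by case=> _ _ _ [_ hmax] _ /hmax[]. Qed.

Lemma form_idealI I Gamma J Delta : form_ideal I Gamma -> form_ideal J Delta ->
  form_ideal (I `&` J) (Gamma `&` Delta).
Proof.
move=> fI fJ; have [[aI mI] bI aG _ cG] := fI; have [[aJ mJ] bJ aD _ cD] := fJ.
have aGD := additive_subgroupI aG aD.
split=> //.
- split; first exact: additive_subgroupI.
  by move=> a x [/(mI a)[? ?] /(mJ a)[? ?]].
- rewrite eqEsubset; split=> [_ [x [Ix Jx] <-]|x [Ix Jx]].
    by split; [exact: (form_ideal_bar fI)|exact: (form_ideal_bar fJ)].
  exists (bar x); last exact: barK.
  by split; [exact: (form_ideal_bar fI)|exact: (form_ideal_bar fJ)].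
- split=> [_ [_ [x [Ix Jx] <-]] [y hy <-]|x [Gx Dx]].
    case: (aGD) => _ hD _; apply: hD.
      by split; [exact: (form_ideal_hermitian fI)|exact: (form_ideal_hermitian fJ)].
    apply: addgen_sub hy => // _ [a [Ia Ja]] [b Lb] <-.
    by split; [exact: (form_ideal_twisted fI)|exact: (form_ideal_twisted fJ)].
  split; last exact: (form_ideal_Lambda fI).
  by split; [exact: (form_ideal_sub fI)|exact: (form_ideal_sub fJ)].
- by move=> a x [Gx Dx]; split; [exact: cG|exact: cD].
Qed.

Lemma sym_product_comaximal I J :
  two_sided_ideal I -> two_sided_ideal J -> sumset I J = setT ->
  sym_product I J = I `&` J.
Proof.
move=> [aI mI] [aJ mJ] IJ.
have [u Iu [v Jv uv]] : sumset I J 1 by rewrite IJ.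
have [_ hD _] := additive_subgroupI aI aJ.
rewrite eqEsubset; split=> [_ [x hx] [y hy <-]|x [Ix Jx]].
  apply: hD.
    apply: addgen_sub hx; first exact: additive_subgroupI.
    by move=> _ [a Ia] [b Jb] <-; split; [case: (mI b _ Ia)|case: (mJ a _ Jb)].
  apply: addgen_sub hy; first exact: additive_subgroupI.
  by move=> _ [b Jb] [a Ia] <-; split; [case: (mI b _ Ia)|case: (mJ a _ Jb)].
exists (x * v); first by apply: sub_addgen; exists x => //; exists v.
exists (x * u); first by apply: sub_addgen; exists x => //; exists u.
by rewrite -mulrDr addrC uv mulr1.
Qed.

(** Expand (u + v) a (u + v)^bar; the two mixed terms combine into a
    hermitian one because elements of Lambda satisfy lambda a^bar = - a. *)
Lemma comaximal_expansion u v a : Lambda A a -> u + v = 1 ->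
  a = u * a * bar u + v * a * bar v
      + (u * a * bar v - lambda A * bar (u * a * bar v)).
Proof.
move=> La uv; have -> : lambda A * bar (u * a * bar v) = - (v * a * bar u).
  by rewrite !barM barK mulrA mulrA lambda_central -(mulrA v) Lambda_barE // mulrN mulNr.
have {1}-> : a = (u + v) * a * bar (u + v) by rewrite uv bar1 mul1r mulr1.
rewrite opprK barD !mulrDl !mulrDr -!addrA; congr (_ + _).
by rewrite addrA addrC.
Qed.

(** This is Lambda = Gamma + Delta.  The mixed term of the expansion may be
    put on either side; here it goes to Gamma. *)
Lemma comaximal_Lambda I Gamma J Delta a :
    form_ideal I Gamma -> form_ideal J Delta -> sumset I J = setT ->
  Lambda A a -> exists2 g, Gamma g & exists2 d, Delta d & g + d = a.
Proof.
move=> fI fJ IJ La.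
have [u Iu [v Jv uv]] : sumset I J 1 by rewrite IJ.
have [[_ mI] _ [_ hD _] _ _] := fI.
exists (u * a * bar u + (u * a * bar v - lambda A * bar (u * a * bar v))).
  apply: hD; first exact: (form_ideal_twisted fI).
  by apply: (form_ideal_hermitian fI); case: (mI (a * bar v) u Iu); rewrite mulrA.
exists (v * a * bar v); first exact: (form_ideal_twisted fJ).
by rewrite addrAC -comaximal_expansion.
Qed.

Lemma sym_product_parameter_comaximal I Gamma J Delta :
    form_ideal I Gamma -> form_ideal J Delta -> sumset I J = setT ->
  sym_product_parameter I Gamma J Delta = Gamma `&` Delta.
Proof.
move=> fI fJ IJ; have [iI bI aG _ cG] := fI; have [iJ bJ aD _ cD] := fJ.
rewrite /sym_product_parameter sym_product_comaximal //.
have fIJ := form_idealI fI fJ; have [_ _ aGD [hmin _] _] := fIJ.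
rewrite eqEsubset; split=> [_ [_ [x hx [y hy <-]]] [z /hmin hz <-]|x [Gx Dx]].
  have [_ hD _] := aGD; apply: (hD) => //; apply: hD.
    apply: addgen_sub hx => // _ [a Ja] [b Gb] <-; split; first exact: cG.
    by apply: (form_ideal_twisted fJ) => //; apply: (form_ideal_Lambda fI).
  apply: addgen_sub hy => // _ [a Ia] [b Db] <-; split; last exact: cD.
  by apply: (form_ideal_twisted fI) => //; apply: (form_ideal_Lambda fJ).
have [u Iu [v Jv uv]] : sumset I J 1 by rewrite IJ.
have Lx := form_ideal_Lambda fI Gx.
exists (v * x * bar v + u * x * bar u).
  exists (v * x * bar v); first by apply: sub_addgen; exists v => //; exists x.
  exists (u * x * bar u) => //.
  by apply: sub_addgen; exists u => //; exists x.
exists (u * x * bar v - lambda A * bar (u * x * bar v)).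
  exists (u * x * bar v - lambda A * bar (u * x * bar v)); last first.
    by exists 0; [exact: addgen0|rewrite addr0].
  exists (u * x * bar v) => //; split.
    by rewrite -mulrA; case: iI => _ /(_ (x * bar v) u Iu)[].
  case: iJ => _ mJ; case: (mJ (bar v) (u * x)) => //.
  by case: (mJ u x); first exact: (form_ideal_sub fJ).
by rewrite [v * _ * _ + _]addrC -comaximal_expansion.
Qed.

End Involution.

(** * Relative unitary congruence groups *)

Section UnitaryGroups.
Variables (A : formRing) (n : nat).
Local Notation Omega := 'I_(2 * n).
Local Notation V := 'cV[A]_(2 * n).
Implicit Types (i j k : Omega) (u v w : V) (g x : GL (2 * n) A).
Implicit Types (a b : A) (I J Gamma Delta : set A).

Lemma GL_mxM g x : GL_mx (g * x)%g = GL_mx g *m GL_mx x.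
Proof. by []. Qed.

Lemma GL_mx1 : GL_mx (1%g : GL (2 * n) A) = 1%:M.
Proof. by []. Qed.

Lemma GL_mxV_mul g u : GL_mx g *m (GL_mx g^-1%g *m u) = u.
Proof. by rewrite mulmxA -GL_mxM mulgV mul1mx. Qed.

Lemma form_fDl u v w : form_f (u + v) w = form_f u w + form_f v w.
Proof.
by rewrite -big_split; apply: eq_bigr => i _; rewrite mxE barD mulrDl.
Qed.

Lemma form_fDr u v w : form_f u (v + w) = form_f u v + form_f u w.
Proof. by rewrite -big_split; apply: eq_bigr => i _; rewrite mxE mulrDr. Qed.

Lemma form_fMr u v a : form_f u (v *m a%:M) = form_f u v * a.
Proof.
rewrite mulr_suml; apply: eq_bigr => i _.
by rewrite mxE big_ord1 !mxE mulr1n mulrA.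
Qed.

Lemma form_fMl u v a : form_f (u *m a%:M) v = bar a * form_f u v.
Proof.
rewrite mulr_sumr; apply: eq_bigr => i _.
by rewrite mxE big_ord1 !mxE mulr1n barM mulrA.
Qed.

Lemma opp_idxK : involutive (@opp_idx n).
Proof. exact: rev_ordK. Qed.

Lemma ltn_opp_idx i : (opp_idx i < n)%N = ~~ (i < n)%N.
Proof.
rewrite -leqNgt /= ltn_subLR ?ltn_ord // [X in (X < _)%N]mul2n -addnn addSn.
by rewrite ltnS leq_add2r.
Qed.

Lemma form_f_deltal i a v :
  form_f (a *: delta_mx i 0) v = if (i < n)%N then bar a * v (opp_idx i) 0 else 0.
Proof.
have E j : bar ((a *: delta_mx i 0 : V) j 0) * v (opp_idx j) 0
    = if j == i then bar a * v (opp_idx i) 0 else 0.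
  by rewrite !mxE andbT; case: eqP => [->|_]; rewrite (mulr1, mulr0) ?bar0 ?mul0r.
rewrite /form_f (eq_bigr _ (fun j _ => E j)) -big_mkcondr /=.
case: ifP => hi; last first.
  by rewrite big_pred0 // => j; case: eqP => [->|]; rewrite ?hi ?andbF.
by rewrite (big_pred1 i) // => j /=; case: eqP => [->|]; rewrite ?hi ?andbF.
Qed.

Lemma form_f_deltar i a u :
  form_f u (a *: delta_mx i 0) = if (i < n)%N then 0 else bar (u (opp_idx i) 0) * a.
Proof.
have E j : bar (u j 0) * (a *: delta_mx i 0 : V) (opp_idx j) 0
    = if j == opp_idx i then bar (u (opp_idx i) 0) * a else 0.
  rewrite !mxE andbT (can2_eq opp_idxK opp_idxK).
  by case: eqP => [->|_]; rewrite (mulr1, mulr0) ?mulr0.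
rewrite /form_f (eq_bigr _ (fun j _ => E j)) -big_mkcondr /=.
case: ifP => hi.
  rewrite big_pred0 // => j; case: eqP => [->|]; rewrite ?andbF //.
  by rewrite ltn_opp_idx hi.
rewrite (big_pred1 (opp_idx i)) // => j /=; case: eqP => [->|]; rewrite ?andbF //.
by rewrite ltn_opp_idx hi.
Qed.

(** Compare the two sides of h (g v, g u) = h (v, u) after moving the values of
    f to one side; this is what makes the cross terms of [defectD] hermitian. *)
Lemma GU_skew g u v : GU g ->
  form_f (GL_mx g *m v) (GL_mx g *m u) - form_f v u
  = - (lambda A * bar (form_f (GL_mx g *m u) (GL_mx g *m v) - form_f u v)).
Proof.
move=> [+ _] => /(_ v u); rewrite /form_h barD barN mulrDr mulrN opprB => e.
by apply/eqP; rewrite subr_eq addrAC eq_sym subr_eq e addrC.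
Qed.

(** The quadratic map measuring how g changes u |-> f (u, u); it takes values
    in Lambda exactly when g preserves q. *)
Definition defect g u := form_f (GL_mx g *m u) (GL_mx g *m u) - form_f u u.

Lemma defectD g u v (a := form_f (GL_mx g *m u) (GL_mx g *m v) - form_f u v) :
  GU g -> defect g (u + v) = defect g u + defect g v + (a - lambda A * bar a).
Proof.
move=> /(@GU_skew g u v) <-; rewrite /defect /a mulmxDr !form_fDl !form_fDr.
rewrite !opprD.
by rewrite (AC ((2*2)*(2*2)) ((1*5)*(4*8)*((2*6)*(3*7))))%AC.
Qed.

Definition entries_in I p q (M : 'M[A]_(p, q)) :=
  forall (r : 'I_p) (s : 'I_q), I (M r s).

Lemma sum_in_subgroup I (T : finType) (F : T -> A) :
  additive_subgroup I -> (forall t, I (F t)) -> I (\sum_t F t).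
Proof. by case=> I0 ID _ IF; elim/big_ind: _. Qed.

Lemma entries_in_mull I p q r (M : 'M[A]_(p, q)) (N : 'M[A]_(q, r)) :
  two_sided_ideal I -> entries_in I N -> entries_in I (M *m N).
Proof.
case=> aI mI IN i j; rewrite mxE; apply: sum_in_subgroup => // k.
by case: (mI (M i k) (N k j)).
Qed.

Lemma entries_in_mulr I p q r (M : 'M[A]_(p, q)) (N : 'M[A]_(q, r)) :
  two_sided_ideal I -> entries_in I M -> entries_in I (M *m N).
Proof.
case=> aI mI IM i j; rewrite mxE; apply: sum_in_subgroup => // k.
by case: (mI (N k j) (M i k)).
Qed.

Lemma form_f_inr I Gamma u v :
  form_ideal I Gamma -> entries_in I v -> I (form_f u v).
Proof.
case=> -[aI mI] _ _ _ _ Iv; rewrite /form_f big_mkcond.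
apply: sum_in_subgroup => // k; case: ifP => _; last by case: aI.
by case: (mI (bar (u k 0)) _ (Iv (opp_idx k) 0)).
Qed.

Lemma subgroup_GU : subgroup (@GU A n).
Proof.
split=> [|g x [gh gq] [xh xq]|g [gh gq]].
- split=> [u v|u]; first by rewrite GL_mx1 !mul1mx.
  by rewrite GL_mx1 !mul1mx subrr; case: (Lambda_form_parameter A) => -[].
- split=> [u v|u]; rewrite GL_mxM -!mulmxA; first by rewrite gh xh.
  rewrite -[X in Lambda A X](subrKA (form_f (GL_mx x *m u) (GL_mx x *m u))).
  by case: (Lambda_form_parameter A) => -[_ + _] _ _ _; apply; [exact: gq|exact: xq].
- split=> [u v|u]; first by rewrite -gh !GL_mxV_mul.
  have := gq (GL_mx g^-1%g *m u); rewrite !GL_mxV_mul.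
  by case: (Lambda_form_parameter A) => -[_ _ +] _ _ _ => /[apply]; rewrite opprB.
Qed.

Section RelativeGroup.
Variables (I Gamma : set A).
Hypothesis fI : form_ideal I Gamma.

Lemma subgroup_GUrel : subgroup (@GUrel A n I Gamma).
Proof.
have [iI _ [G0 GD GN] _ _] := fI; have [[I0 ID IN] mI] := iI.
have [GU1 GUM GUV] := subgroup_GU.
split=> [|g x [Ug gI gG] [Ux xI xG]|g [Ug gI gG]].
- split; first exact: GU1.
    by move=> i j; rewrite GL_mx1 subrr mxE.
  by move=> u; rewrite GL_mx1 !mul1mx subrr.
- split; first exact: GUM.
    move=> i j.
    have -> : GL_mx (g * x)%g - 1%:M
        = (GL_mx g - 1%:M) *m GL_mx x + (GL_mx x - 1%:M).
      by rewrite mulmxBl mul1mx subrKA.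
    by rewrite mxE; apply: ID; [exact: entries_in_mulr|exact: xI].
  move=> u; rewrite GL_mxM -!mulmxA.
  by rewrite -[X in Gamma X](subrKA (form_f (GL_mx x *m u) (GL_mx x *m u))); exact: GD.
- split; first exact: GUV.
    move=> i j.
    have -> : GL_mx g^-1%g - 1%:M
        = - ((GL_mx g - 1%:M) *m GL_mx g^-1%g).
      by rewrite mulmxBl -GL_mxM mulgV mul1mx opprB.
    by rewrite mxE; apply: IN; exact: entries_in_mulr.
  move=> u; have := GN _ (gG (GL_mx g^-1%g *m u)).
  by rewrite !GL_mxV_mul opprB.
Qed.

(** By [defectD] this is the deviation of the defect from additivity; it is a
    hermitian element of I as soon as one argument has entries in I. *)
Lemma cross_in x u v (a := form_f (GL_mx x *m u) (GL_mx x *m v) - form_f u v) :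
  entries_in I v -> Gamma (a - lambda A * bar a).
Proof.
move=> Iv; have [iI _ _ _ _] := fI; apply: (form_ideal_hermitian fI).
apply: additive_subgroupB; first by case: iI.
  by apply: (form_f_inr _ fI); exact: entries_in_mull.
exact: (form_f_inr _ fI).
Qed.

(** Decompose u into the columns e_i u_i.  On each of them the defect is
    u_i^bar (defect x e_i) u_i, a twist of an element of Lambda by I, and the
    cross terms are hermitian. *)
Lemma defect_in x u : GU x -> entries_in I u -> Gamma (defect x u).
Proof.
move=> Ux Iu; have [iI _ [G0 GD GN] _ _] := fI; have [[I0 ID IN] mI] := iI.
have -> : u = \sum_i delta_mx i 0 *m (u i 0)%:M.
  rewrite [LHS]matrix_sum_delta; apply: eq_bigr => i _; rewrite big_ord1.
  apply/matrixP => r s; rewrite !mxE big_ord1 !mxE !ord1 /= mulr1n.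
  by case: (r == i); rewrite ?(mulr1, mulr0, mul1r, mul0r).
have [] // : entries_in I (\sum_i delta_mx i 0 *m (u i 0)%:M : V) /\
  Gamma (defect x (\sum_i delta_mx i 0 *m (u i 0)%:M)).
elim/big_ind: _ => [|v w [Iv Gv] [Iw Gw]|i _].
- split; first by move=> i j; rewrite mxE.
  by rewrite /defect mulmx0 subrr.
- split; first by move=> i j; rewrite mxE; exact: ID.
  by rewrite defectD //; apply: (GD); [exact: GD|exact: cross_in].
- split.
    by apply: entries_in_mull => // r s; rewrite mxE !ord1 mulr1n.
  rewrite /defect mulmxA !form_fMr !form_fMl -mulrBl -mulrBr.
  rewrite -[X in _ * X]barK; apply: (form_ideal_twisted fI).
    exact: (form_ideal_bar fI).
  by case: Ux.
Qed.

(** With v = x^-1 u and g v = v + w, where w has entries in I, the defect of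
    the conjugate at u is the defect of g at v plus the difference of the
    defects of x at v + w and at v; the latter lies in Gamma by [defect_in]
    and [cross_in]. *)
Lemma normalises_GUrel : normalises (@GU A n) (@GUrel A n I Gamma).
Proof.
have [iI _ [G0 GD GN] _ _] := fI; have [GU1 GUM GUV] := subgroup_GU.
move=> x g Ux [Ug gI gG]; split.
- by apply: (GUM); [exact: GUM|exact: GUV].
- move=> i j.
  have -> : GL_mx (x * g * x^-1)%g - 1%:M
      = GL_mx x *m ((GL_mx g - 1%:M) *m GL_mx x^-1%g).
    by rewrite mulmxBl mulmxBr mul1mx mulmxA -!GL_mxM mulgV.
  by apply: entries_in_mull => //; exact: entries_in_mulr.
- move=> u; rewrite !GL_mxM -!mulmxA; set v := GL_mx x^-1%g *m u.
  have -> : u = GL_mx x *m v by rewrite GL_mxV_mul.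
  pose w := (GL_mx g - 1%:M) *m v.
  have Iw : entries_in I w by exact: entries_in_mulr.
  have gv : GL_mx g *m v = v + w by rewrite /w mulmxBl mul1mx addrC subrK.
  have -> : form_f (GL_mx x *m (GL_mx g *m v)) (GL_mx x *m (GL_mx g *m v))
      - form_f (GL_mx x *m v) (GL_mx x *m v)
    = (defect x (v + w) - defect x v) + (form_f (GL_mx g *m v) (GL_mx g *m v) - form_f v v).
    by rewrite /defect -gv opprB addrAC !subrKA.
  apply: (GD); last exact: gG.
  rewrite defectD // addrC addrA addKr.
  by apply: (GD); [exact: defect_in|exact: cross_in].
Qed.

Lemma GUrel_sub_CU : @GUrel A n I Gamma `<=` @CU A n I Gamma.
Proof.
have [_ GM GV] := subgroup_GUrel; move=> g hg; split; first by case: hg.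
move=> x Ux; rewrite /comm -[X in GUrel _ _ X]mulgA -[X in GUrel _ _ X]mulgA.
by apply: (GM) => //; rewrite mulgA; apply: normalises_GUrel => //; exact: GV.
Qed.

End RelativeGroup.

End UnitaryGroups.

(** * Elementary unitary matrices *)

Section ElementaryGroups.
Variables (A : formRing) (n : nat).
Local Notation Omega := 'I_(2 * n).
Local Notation V := 'cV[A]_(2 * n).
Implicit Types (i j k : Omega) (u v w : V) (g x : GL (2 * n) A).
Implicit Types (a b : A) (I J Gamma Delta : set A).

(** If g changes f by a sesquilinear form D, then D being (-lambda)-hermitian
    gives the preservation of h, and the values D u u decide the rest. *)
Lemma elementary_GUrel g (D : V -> V -> A) I Gamma :
    form_ideal I Gamma ->
    (forall u v, form_f (GL_mx g *m u) (GL_mx g *m v) = form_f u v + D u v) ->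
    (forall u v, D u v = - (lambda A * bar (D v u))) ->
    (forall u, Gamma (D u u)) -> entries_in I (GL_mx g - 1%:M) ->
  GUrel I Gamma g.
Proof.
move=> fI gD skewD GD gI; split=> //; last by move=> u; rewrite gD addrC addKr.
split=> [u v|u]; last first.
  by rewrite gD addrC addKr; apply: (form_ideal_Lambda fI).
by rewrite /form_h !gD barD mulrDr addrACA [D u v]skewD addNr addr0.
Qed.

Lemma lambda_pow_eps i j : lambda_pow A ((eps j - eps i) %/ 2)%Z =
  if (i < n)%N then if (j < n)%N then 1 else bar (lambda A)
  else if (j < n)%N then lambda A else 1.
Proof.
by rewrite /eps; case: (i < n)%N; case: (j < n)%N; rewrite /= ?expr0 ?expr1.
Qed.

Lemma scaled_parameterE i Gamma : scaled_parameter i Gamma =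
  [set (if (i < n)%N then bar (lambda A) else 1) * a | a in Gamma].
Proof.
rewrite /scaled_parameter /eps; case: (i < n)%N => /=; last by rewrite expr0.
by rewrite expr1.
Qed.

Lemma opp_idx_inj : injective (@opp_idx n).
Proof. exact: rev_ord_inj. Qed.

Lemma scale_delta_mul p a b i j (l : 'I_p) :
  (a *: delta_mx i j : 'M[A]_(2 * n)) *m (b *: delta_mx j l) = (a * b) *: delta_mx i l.
Proof.
apply/matrixP => r s; rewrite !mxE (bigD1 j) //= big1 => [|t tj].
  rewrite !mxE !eqxx andbT /= addr0.
  by case: (r == i); case: (s == l); rewrite ?(mulr1, mulr0, mul0r).
by rewrite !mxE (negbTE tj) andbF mulr0 mul0r.
Qed.

Lemma scale_delta_act a i j u :
  (a *: delta_mx i j : 'M[A]_(2 * n)) *m u = (a * u j 0) *: delta_mx i 0.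
Proof.
apply/matrixP => r s; rewrite !mxE (bigD1 j) //= big1 => [|t tj].
  rewrite !mxE eqxx !ord1 !andbT addr0.
  by case: (r == i); rewrite ?(mulr1, mulr0, mul0r).
by rewrite !mxE (negbTE tj) andbF mulr0 mul0r.
Qed.

Lemma entries_in_scale_delta I a i j :
  two_sided_ideal I -> I a -> entries_in I (a *: delta_mx i j : 'M[A]_(2 * n)).
Proof. by case=> _ mI Ia r s; rewrite !mxE; case: (mI (((r == i) && (s == j))%:R) a Ia). Qed.

(** For i and j of equal sign T_ij preserves f itself.  For opposite signs it
    changes f by x (u, v) - lambda x (v, u)^bar, with x valued in I. *)
Lemma T_mx_GUrel I Gamma g i j a : form_ideal I Gamma ->
    i != j -> i != opp_idx j -> I a -> GL_mx g = T_mx i j a ->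
  GUrel I Gamma g.
Proof.
move=> fI ij iNj Ia gE; have [iI _ _ _ _] := fI; have [[I0 ID IN] mI] := iI.
pose x u v := if (i < n)%N == (j < n)%N then 0
  else if (i < n)%N then bar (u j 0) * bar a * v (opp_idx i) 0
  else bar (u (opp_idx i) 0) * a * v j 0.
have Iab b c d : I c -> I (b * c * d).
  by move=> Ic; case: (mI b c) => // Ibc _; case: (mI d (b * c)).
have Ix u : I (x u u).
  rewrite /x; case: ifP => // _; case: ifP => _; apply: Iab => //.
  exact: (form_ideal_bar fI).
apply: (@elementary_GUrel g (fun u v => x u v - lambda A * bar (x v u))) => //.
- move=> u v; rewrite gE /T_mx lambda_pow_eps.
  set c := _ * bar a.
  have act (z : V) : (1%:M + a *: delta_mx i j - c *: delta_mx (opp_idx j) (opp_idx i)) *m z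
    = z + (a * z j 0) *: delta_mx i 0
        + (- c * z (opp_idx i) 0) *: delta_mx (opp_idx j) 0.
    by rewrite -scaleNr !mulmxDl mul1mx !scale_delta_act.
  rewrite !act !form_fDl !form_fDr !form_f_deltal !form_f_deltar !ltn_opp_idx.
  rewrite !mxE !eqxx !opp_idxK !(inj_eq opp_idx_inj) !(negbTE (opp_idx_neq _)).
  rewrite (negbTE ij) [j == i]eq_sym (negbTE ij).
  rewrite [j == opp_idx j]eq_sym (negbTE (opp_idx_neq j)) /= !mulr0 !if_same !addr0.
  rewrite -!addrA; congr (_ + _); rewrite /x /c.
  case: (i < n)%N; case: (j < n)%N => /=.
  + rewrite bar0 mulr0 subr0 mul1r barM !add0r addr0 mulNr mulrN !mulrA.
    by rewrite addNr.
  + rewrite !barM !barK barN barM !barK !add0r mulrN mulNr !mulrA.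
    by rewrite -(lambda_central (_ * a)) !mulrA.
  + rewrite !barM !barK !addr0 mulNr mulrN !mulrA.
    by rewrite -(lambda_central (bar (u j 0))).
  + rewrite bar0 mulr0 subr0 mul1r barM barN barK !add0r !mulrA.
    by rewrite mulrN mulNr addrN.
- move=> u v; rewrite barD barN barM barK -bar_lambdaC mulrDr mulrN.
  by rewrite mul_lambda_bar_lambda opprB.
- by move=> u; apply: (form_ideal_hermitian fI).
- rewrite gE /T_mx addrC !addrA addNr add0r => r s; rewrite mxE.
  apply: ID; first exact: entries_in_scale_delta.
  rewrite -scaleNr; apply: entries_in_scale_delta => //.
  by apply: IN; case: (mI (lambda_pow A ((eps j - eps i) %/ 2)%Z) (bar a)) => //;
    apply: (form_ideal_bar fI).
Qed.

Lemma scaled_parameter_in I Gamma i a :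
  form_ideal I Gamma -> scaled_parameter i Gamma a -> I a.
Proof.
move=> fI; rewrite scaled_parameterE => -[g /(form_ideal_sub fI) Ig <-].
by case: fI => -[_ mI] _ _ _ _; case: (mI (if (i < n)%N then bar (lambda A) else 1) g).
Qed.

(** Here f changes by u_{-i}^bar d v_{-i} with d in Gamma, up to sign the
    element of Gamma from which the scaled parameter comes. *)
Lemma T_opp_mx_GUrel I Gamma g i a : form_ideal I Gamma ->
    scaled_parameter i Gamma a -> GL_mx g = T_opp_mx i a ->
  GUrel I Gamma g.
Proof.
move=> fI Ga gE; have [iI _ aG _ cG] := fI; have [G0 GD GN] := aG.
have Ia := scaled_parameter_in fI Ga.
move: Ga; rewrite scaled_parameterE => -[c Gc /esym aE].
have cL : lambda A * bar c = - c by apply/Lambda_barE/(form_ideal_Lambda fI Gc).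
pose d := if (i < n)%N then - c else c.
have dL : lambda A * bar d = - d by rewrite /d; case: ifP; rewrite ?barN ?mulrN cL.
have Gd : Gamma d by rewrite /d; case: ifP => // _; exact: GN.
apply: (@elementary_GUrel g
  (fun u v => bar (u (opp_idx i) 0) * d * v (opp_idx i) 0)) => //.
- move=> u v; rewrite gE /T_opp_mx !mulmxDl !mul1mx !scale_delta_act.
  rewrite !form_fDl !form_fDr !form_f_deltal !form_f_deltar !mxE.
  rewrite (negbTE (opp_idx_neq _)) /= !mulr0 if_same addr0 -addrA; congr (_ + _).
  rewrite aE /d; case: (i < n)%N.
    by rewrite add0r !barM barK -(lambda_central (bar c)) cL.
  by rewrite mul1r addr0 mulrA.
- move=> u v; rewrite !barM barK !mulrA lambda_central -!mulrA.
  by rewrite [lambda A * _]mulrA dL mulNr mulrN opprK.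
- by move=> u; have := cG (bar (u (opp_idx i) 0)) d Gd; rewrite barK.
- by rewrite gE /T_opp_mx addrC addKr; exact: entries_in_scale_delta.
Qed.

Lemma FU_GUrel I Gamma : form_ideal I Gamma ->
  @FU A n I Gamma `<=` @GUrel A n I Gamma.
Proof.
move=> fI; apply: gengroup_sub; first exact: subgroup_GUrel.
move=> g [[i [j [a [ij iNj Ia gE]]]]|[i [a Ga gE]]].
  exact: (T_mx_GUrel fI ij iNj Ia gE).
exact: (T_opp_mx_GUrel fI Ga gE).
Qed.

Lemma form_idealT : form_ideal [set: A] (Lambda A).
Proof.
have [aL minL maxL cL] := Lambda_form_parameter A; have [L0 LD LN] := aL.
split=> //.
- rewrite eqEsubset; split=> // a _; exists (bar a) => //; exact: barK.
- split=> [_ [_ [x _ <-]] [y hy <-]|x Lx]; last by split.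
  apply: LD; first by apply: minL; exists x.
  by apply: addgen_sub hy => // _ [b _] [c Lc] <-; exact: cL.
Qed.

Lemma subgroup_EUabs : subgroup (@EUabs A n).
Proof. exact: gengroup_subgroup. Qed.

Lemma normalises_EU I Gamma : normalises (@EUabs A n) (EU n I Gamma).
Proof. exact: (normalises_normal_closure subgroup_EUabs). Qed.

Lemma normalises_EUabs : normalises (@EUabs A n) (@EUabs A n).
Proof.
have [_ EM EV] := subgroup_EUabs => e x Ee Ex.
by apply: (EM); [exact: EM|exact: EV].
Qed.

Lemma EUabs_GU : @EUabs A n `<=` @GU A n.
Proof. by move=> g /(FU_GUrel form_idealT)[]. Qed.

Lemma EU_GUrel I Gamma : form_ideal I Gamma ->
  EU n I Gamma `<=` @GUrel A n I Gamma.
Proof.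
move=> fI; apply: normal_closure_sub; last exact: FU_GUrel.
- exact: subgroup_GUrel.
- by move=> e x /EUabs_GU; exact: normalises_GUrel.
Qed.

Lemma FU_mono I J Gamma Delta : I `<=` J -> Gamma `<=` Delta ->
  @FU A n I Gamma `<=` @FU A n J Delta.
Proof.
move=> IJ GD; apply: gengroup_sub; first exact: gengroup_subgroup.
move=> g [[i [j [a [ij iNj Ia gE]]]]|[i [_ [c Gc <-] gE]]]; apply: sub_gengroup.
  by left; exists i, j, a; split=> //; exact: IJ.
by right; exists i; eexists; [exists c; [exact: GD|]|exact: gE].
Qed.

Lemma EU_mono I J Gamma Delta : I `<=` J -> Gamma `<=` Delta ->
  EU n I Gamma `<=` EU n J Delta.
Proof.
move=> IJ GD; apply: normal_closure_sub.
- exact: normal_closure_subgroup.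
- exact: normalises_EU.
- apply: (subset_trans (FU_mono IJ GD)).
  exact: (sub_normal_closure subgroup_EUabs).
Qed.

Lemma EU_EUabs I Gamma : form_ideal I Gamma -> EU n I Gamma `<=` @EUabs A n.
Proof.
move=> fI; apply: normal_closure_sub.
- exact: subgroup_EUabs.
- exact: normalises_EUabs.
- by apply: FU_mono => // a; exact: (form_ideal_Lambda fI).
Qed.

(** The hypotheses on X, Y and Z amount to g x = c x g, with the inverses
    of g and x eliminated. *)
Lemma comm_unipotent g x (c : GL (2 * n) A) (X Y Z : 'M[A]_(2 * n)) :
    GL_mx g = 1%:M + X -> GL_mx x = 1%:M + Y -> GL_mx c = 1%:M + Z ->
    X *m Y = Y *m X + Z + Z *m X -> Z *m Y = 0 ->
  comm g x = c.
Proof.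
move=> gE xE cE XY ZY; have gx : (g * x = c * (x * g))%g.
  apply: GL_mx_inj; rewrite !GL_mxM gE xE cE.
  rewrite !(mulmxDl, mulmxDr, mul1mx, mulmx1) !mulmxA ZY mul0mx XY !addr0.
  by rewrite -!addrA [Y + (X + _)]addrCA.
by rewrite /comm gx !mulgA mulgK mulgK.
Qed.

(** Three absolute values are available and at most two are taken by i and j;
    the sign of k is free. *)
Lemma exists_index i j : (3 <= n)%N ->
  exists k, [/\ (k < n)%N = (j < n)%N,
    k != i /\ k != opp_idx i & k != j /\ k != opp_idx j].
Proof.
move=> n3; pose h i := if (i < n)%N then val i else val (opp_idx i).
have hopp l : h (opp_idx l) = h l.
  by rewrite /h ltn_opp_idx opp_idxK; case: (l < n)%N.
have [m [m3 mi mj]] : exists m, [/\ (m < 3)%N, m != h i & m != h j].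
  move: (h i) (h j) => p q.
  by case: p q => [|[|p]] [|[|q]]; [exists 1%N|exists 2%N|exists 1%N|exists 2%N
    |exists 2%N|exists 0%N|exists 1%N|exists 0%N|exists 0%N].
have mn : (m < n)%N by exact: leq_trans m3 n3.
have m2n : (m < 2 * n)%N by rewrite (leq_trans mn) // leq_pmull.
pose k0 : Omega := Ordinal m2n.
have hk0 : h k0 = m by rewrite /h /= mn.
pose k := if (j < n)%N then k0 else opp_idx k0.
have hk : h k = m by rewrite /k; case: ifP; rewrite ?hopp hk0.
exists k; split.
- by rewrite /k; case: ifP => hj; rewrite ?ltn_opp_idx /= mn.
- by split; apply: contraNneq mi => kE; rewrite -hk kE ?hopp.
- by split; apply: contraNneq mj => kE; rewrite -hk kE ?hopp.
Qed.

Lemma opp_idx_eq (l m : Omega) : (opp_idx l == m) = (l == opp_idx m).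
Proof. by rewrite (can2_eq (@opp_idxK n) (@opp_idxK n)). Qed.

Lemma eq_opp_idxF (l : Omega) : (l == opp_idx l) = false.
Proof. by rewrite eq_sym (negbTE (opp_idx_neq l)). Qed.

Lemma separated_eqF (l m : Omega) : l != m -> l != opp_idx m ->
  ((l == m) = false) * ((m == l) = false) * ((l == opp_idx m) = false)
   * ((m == opp_idx l) = false).
Proof.
by move=> /negbTE lm /negbTE lNm; rewrite ![m == _]eq_sym opp_idx_eq lm lNm.
Qed.

Lemma scale_delta_mul0 a b (k l m k' : Omega) : (l == m) = false ->
  (a *: delta_mx k l : 'M[A]_(2 * n)) *m (b *: delta_mx m k') = 0.
Proof. by move=> /negbT; exact: mul_scale_delta. Qed.

(** Taking k of the sign of j makes the power of lambda in T_kj trivial, so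
    the commutator carries exactly the power occurring in T_ij. *)
Lemma comm_T_mx g x (c : GL (2 * n) A) i j k a :
    i != j -> i != opp_idx j -> k != i -> k != opp_idx i ->
    k != j -> k != opp_idx j -> (k < n)%N = (j < n)%N ->
    GL_mx g = T_mx i k a -> GL_mx x = T_mx k j 1 -> GL_mx c = T_mx i j a ->
  comm g x = c.
Proof.
move=> ij iNj ki kNi kj kNj kn; rewrite /T_mx !lambda_pow_eps kn -!addrA.
have -> : (if (j < n)%N then if (j < n)%N then 1 else bar (lambda A)
  else if (j < n)%N then lambda A else 1) = 1 by case: (j < n)%N.
set b := _ * bar a; rewrite bar1 mulr1 -!scaleNr => gE xE cE.
have idxE := (separated_eqF ij iNj, separated_eqF ki kNi, separated_eqF kj kNj,
  eq_opp_idxF, opp_idx_eq, opp_idxK).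
apply: (comm_unipotent gE xE cE); rewrite !(mulmxDl, mulmxDr).
  rewrite !scale_delta_mul !scale_delta_mul0 ?idxE //.
  rewrite mulr1 mulN1r opprK !(addr0, add0r) scaleNr.
  by rewrite addrCA subrr addr0.
by rewrite !scale_delta_mul0 ?idxE // !addr0.
Qed.

(** For i and j of equal sign the scaled parameters at i and j coincide, so a
    serves at both long roots; membership in the scaled Lambda also makes the
    two off-diagonal entries of T_{i,-j} a equal. *)
Lemma comm_T_opp_mx Gamma g x (c d : GL (2 * n) A) i j a :
    Gamma `<=` Lambda A -> scaled_parameter i Gamma a ->
    j != i -> j != opp_idx i -> (j < n)%N = (i < n)%N ->
    GL_mx g = T_mx i j 1 -> GL_mx x = T_opp_mx j a ->
    GL_mx c = T_mx i (opp_idx j) a -> GL_mx d = T_opp_mx i a ->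
  comm g x = (c * d)%g.
Proof.
move=> GL; rewrite scaled_parameterE => -[s /GL /Lambda_barE sL aE] ji jNi jn.
rewrite /T_mx /T_opp_mx !lambda_pow_eps ltn_opp_idx jn opp_idxK -!addrA.
have -> : (if (i < n)%N then if (i < n)%N then 1 else bar (lambda A)
  else if (i < n)%N then lambda A else 1) = 1 by case: (i < n)%N.
have -> : (if (i < n)%N then if ~~ (i < n)%N then 1 else bar (lambda A)
  else if ~~ (i < n)%N then lambda A else 1) * bar a = - a.
  move: aE; case: (i < n)%N => /= <-; last by rewrite !mul1r.
  by rewrite barM barK -lambda_central sL mulrN.
rewrite bar1 mulr1 -!scaleNr opprK => gE xE cE dE.
have idxE := (separated_eqF ji jNi, eq_opp_idxF, opp_idx_eq, opp_idxK).
have cdE : GL_mx (c * d)%g = 1%:M + (a *: delta_mx i (opp_idx j)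
    + (a *: delta_mx j (opp_idx i) + a *: delta_mx i (opp_idx i))).
  rewrite GL_mxM cE dE mulmxDr mulmx1 !mulmxDl mul1mx.
  by rewrite !scale_delta_mul0 ?idxE // !addr0 -!addrA.
apply: (comm_unipotent gE xE cdE); rewrite !(mulmxDl, mulmxDr).
  rewrite !scale_delta_mul !scale_delta_mul0 ?idxE //.
  rewrite mul1r mulrN1 !addr0 !add0r !scaleNr.
  by rewrite !addrA addrK addrAC addNr add0r.
by rewrite !scale_delta_mul0 ?idxE // !addr0.
Qed.

(** * Commutators of relative elementary subgroups *)

(** Short root elements are commutators of short root elements through a third
    index; a long root element is a commutator times a short root element,
    which has already been obtained. *)
Lemma EU_perfect I Gamma : (3 <= n)%N -> form_ideal I Gamma ->
  EU n I Gamma `<=` commgroup (EU n I Gamma) (@EUabs A n).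
Proof.
move=> n3 fI; set N := commgroup _ _.
have sN : subgroup N by exact: gengroup_subgroup.
have sFU : @FU A n I Gamma `<=` EU n I Gamma.
  exact: (sub_normal_closure subgroup_EUabs).
have genEU g : elementary_gen I Gamma g -> EU n I Gamma g.
  by move=> hg; apply: sFU; exact: sub_gengroup.
have genE g : elementary_gen setT (Lambda A) g -> @EUabs A n g.
  exact: sub_gengroup.
have NT i j a c : i != j -> i != opp_idx j -> I a -> GL_mx c = T_mx i j a -> N c.
  move=> ij iNj Ia cE; have [k [kn [ki kNi] [kj kNj]]] := exists_index i j n3.
  have ik : i != k by rewrite eq_sym.
  have iNk : i != opp_idx k by rewrite -opp_idx_eq eq_sym.
  have [g gE] := T_mx_GL a ik; have [x xE] := T_mx_GL (1 : A) kj.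
  rewrite -(comm_T_mx ij iNj ki kNi kj kNj kn gE xE cE).
  apply: commgroup_comm; [apply: genEU|apply: genE]; left.
    by exists i, k, a.
  by exists k, j, 1.
apply: normal_closure_sub => //.
  exact: (normalises_commgroup (@normalises_EU _ _) normalises_EUabs).
apply: gengroup_sub => // d [[i [j [a [ij iNj Ia dE]]]]|[i [a Ga dE]]].
  exact: (NT _ _ _ _ ij iNj Ia dE).
have [j [jn [ji jNi] _]] := exists_index i i n3.
have iNj : i != opp_idx j by rewrite -opp_idx_eq eq_sym.
have ij : i != j by rewrite eq_sym.
have [g gE] := T_mx_GL (1 : A) ij; have [x xE] := T_opp_mx_GL j a.
have [c cE] := T_mx_GL a iNj.
have GL : Gamma `<=` Lambda A by move=> b; exact: (form_ideal_Lambda fI).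
have -> : d = (c^-1 * comm g x)%g.
  by rewrite (comm_T_opp_mx GL Ga ji jNi jn gE xE cE dE) mulgA mulVg mul1g.
have [_ NM NV] := sN; apply: (NM).
  apply: NV; apply: (NT i (opp_idx j) a) => //; first by rewrite opp_idxK.
  exact: (scaled_parameter_in fI Ga).
rewrite -commV; apply: NV; apply: commgroup_comm; [apply: genEU|apply: genE].
  right; exists j; exists a => //.
  by move: Ga; rewrite !scaled_parameterE jn.
by left; exists i, j, 1.
Qed.

Lemma T_mxD i j a b : i != j ->
  T_mx i j (a + b) = T_mx i j a *m T_mx i j b :> 'M[A]_(2 * n).
Proof.
move=> ij; have Nij : opp_idx i != opp_idx j by rewrite (inj_eq opp_idx_inj).
rewrite /T_mx -!addrA -!scaleNr !(mulmxDl, mulmxDr, mul1mx, mulmx1).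
rewrite !mul_scale_delta ?opp_idx_neq // 1?eq_sym ?opp_idx_neq //.
rewrite barD mulrDr opprD !scalerDl !addr0 -!addrA; congr (_ + _).
by rewrite [RHS]addrA [RHS]addrC addrACA -!addrA.
Qed.

Lemma T_opp_mxD i a b :
  T_opp_mx i (a + b) = T_opp_mx i a *m T_opp_mx i b :> 'M[A]_(2 * n).
Proof.
rewrite /T_opp_mx mulmxDl mul1mx mulmxDr mulmx1.
rewrite mul_scale_delta ?opp_idx_neq // addr0 scalerDl.
by rewrite [a *: _ + _]addrC addrA.
Qed.

(** Each elementary generator is additive in its parameter, and its parameter
    splits: A = I + J for short roots, Lambda = Gamma + Delta for long ones. *)
Lemma EUabs_comaximal I Gamma J Delta :
    form_ideal I Gamma -> form_ideal J Delta -> sumset I J = setT ->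
  @EUabs A n `<=` gengroup (EU n I Gamma `|` EU n J Delta).
Proof.
move=> fI fJ IJ; have [_ NM _] := gengroup_subgroup (EU n I Gamma `|` EU n J Delta).
have genI g : elementary_gen I Gamma g -> gengroup (EU n I Gamma `|` EU n J Delta) g.
  move=> hg; apply: sub_gengroup; left.
  by apply: (sub_normal_closure subgroup_EUabs); exact: sub_gengroup.
have genJ g : elementary_gen J Delta g -> gengroup (EU n I Gamma `|` EU n J Delta) g.
  move=> hg; apply: sub_gengroup; right.
  by apply: (sub_normal_closure subgroup_EUabs); exact: sub_gengroup.
apply: gengroup_sub; first exact: gengroup_subgroup.
move=> c [[i [j [a [ij iNj _ cE]]]]|[i [_ [a La <-] cE]]].
  have [u Iu [v Jv uv]] : sumset I J a by rewrite IJ.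
  have [g gE] := T_mx_GL u ij; have [x xE] := T_mx_GL v ij.
  have -> : c = (g * x)%g.
    by apply: GL_mx_inj; rewrite GL_mxM gE xE cE -uv T_mxD.
  by apply: NM; [apply: genI|apply: genJ]; left; [exists i, j, u|exists i, j, v].
have [u Gu [v Dv uv]] := comaximal_Lambda fI fJ IJ La.
set l := lambda_pow A _ in cE.
have [g gE] := T_opp_mx_GL i (l * u); have [x xE] := T_opp_mx_GL i (l * v).
have -> : c = (g * x)%g.
  by apply: GL_mx_inj; rewrite GL_mxM gE xE cE -uv mulrDr T_opp_mxD.
apply: NM; [apply: genI|apply: genJ]; right; exists i.
  by exists (l * u) => //; exists u.
by exists (l * v) => //; exists v.
Qed.

Lemma commgroup_EU_GUrel I Gamma J Delta :
    form_ideal I Gamma -> form_ideal J Delta ->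
  commgroup (EU n I Gamma) (EU n J Delta)
    `<=` @GUrel A n (I `&` J) (Gamma `&` Delta).
Proof.
move=> fI fJ; apply: commgroup_sub => [|g x /(EU_GUrel fI) gI /(EU_GUrel fJ) xJ].
  exact: (subgroup_GUrel n (form_idealI fI fJ)).
have [_ IM IV] := subgroup_GUrel n fI.
have [_ JM JV] := subgroup_GUrel n fJ.
have [Ug _ _] := gI; have [Ux _ _] := xJ.
have [Uc cI cG] : GUrel I Gamma (comm g x).
  rewrite /comm -!mulgA; apply: (IM) => //; rewrite mulgA.
  by apply: normalises_GUrel => //; exact: IV.
have [_ cJ cD] : GUrel J Delta (comm g x).
  by apply: (JM); [exact: normalises_GUrel|exact: JV].
by split=> // [i j|u]; split.
Qed.

End ElementaryGroups.

Unset Implicit Arguments.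

Theorem theorem3 (n : nat) (A : formRing) (I Gamma J Delta : set A) :
  (3 <= n)%N ->
  absolute_standard_commutator_formulae A n ->
  form_ideal I Gamma ->
  form_ideal J Delta ->
  sumset I J = setT ->
  commgroup (EU n I Gamma) (EU n J Delta) =
  EU n (sym_product I J) (sym_product_parameter I Gamma J Delta).
Proof.
move=> n3 SCF fI fJ IJ.
have [iI _ _ _ _] := fI; have [iJ _ _ _ _] := fJ.
rewrite (sym_product_comaximal iI iJ IJ).
rewrite (sym_product_parameter_comaximal fI fJ IJ).
have fK := form_idealI fI fJ; set K := I `&` J in fK *; set L := Gamma `&` Delta in fK *.
apply: (@commgroup_factors _ (@EUabs A n)).
- exact: subgroup_EUabs.
- exact: normal_closure_subgroup.
- exact: normal_closure_subgroup.
- exact: normal_closure_subgroup.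
- exact: normalises_EU.
- exact: normalises_EU.
- exact: normalises_EU.
- exact: EU_EUabs fI.
- exact: EU_EUabs fJ.
- by apply: EU_mono => a [].
- by apply: EU_mono => a [].
- exact: EUabs_comaximal fI fJ IJ.
- exact: EU_perfect.
- exact: EU_perfect.
- apply: commgroup_sub; first exact: normal_closure_subgroup.
  move=> z e /(commgroup_EU_GUrel fI fJ)/(GUrel_sub_CU fK) zC Ee.
  have [_ _ LV] : subgroup (EU n K L) by exact: normal_closure_subgroup.
  rewrite -commV; apply: LV; have [_ ->] := SCF _ _ fK.
  exact: commgroup_comm.
Qed.
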